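(* There is a constant $C$ such that for every $N$ and all binary strings $a,b,c$ of length at most $N$ there exists a binary string $f$ such that (1) $\mathrm{KS}(b\mid a,f)\le C\log N$, and (2) $\bigl|\mathrm{KS}(b\mid c,f)-\min\{\mathrm{KS}(a\mid c),\mathrm{KS}(b\mid c)\}\bigr|\le C\log N$.
   Context: $\mathrm{KS}(u\mid v)$ denotes conditional Kolmogorov complexity with respect to a fixed optimal programming language; $\mathrm{KS}(u\mid v,w)$ is complexity conditional on (an encoding of) the pair $\langle v,w\rangle$. *)

(* Defs.v *)
From Stdlib Require Import List Arith PeanoNat ClassicalEpsilon.
Import ListNotations.

Inductive mrec : Type :=
| MZero : mrec
| MSucc : mrec
| MProj : nat -> mrec
| MComp : mrec -> list mrec -> mrec
| MPrec : mrec -> mrec -> mrec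
| MMu   : mrec -> mrec.

Inductive eval : mrec -> list nat -> nat -> Prop :=
| ev_zero xs : eval MZero xs 0
| ev_succ xs : eval MSucc xs (S (hd 0 xs))
| ev_proj i xs : eval (MProj i) xs (nth i xs 0)
| ev_comp f gs xs ys y :
    evals gs xs ys -> eval f ys y -> eval (MComp f gs) xs y
| ev_prec0 f g xs y : eval f xs y -> eval (MPrec f g) (0 :: xs) y
| ev_precS f g n xs y z :
    eval (MPrec f g) (n :: xs) y -> eval g (n :: y :: xs) z ->
    eval (MPrec f g) (S n :: xs) z
| ev_mu f xs n :
    eval f (n :: xs) 0 ->
    (forall m, m < n -> exists k, eval f (m :: xs) (S k)) ->
    eval (MMu f) xs n
with evals : list mrec -> list nat -> list nat -> Prop :=
| evs_nil xs : evals [] xs []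
| evs_cons g gs xs y ys :
    eval g xs y -> evals gs xs ys -> evals (g :: gs) xs (y :: ys).

Definition bits := list bool.

(** injective encoding of binary strings as naturals (binary with leading 1) *)
Fixpoint enc (s : bits) : nat :=
  match s with
  | [] => 1
  | b :: l => 2 * enc l + (if b then 1 else 0)
  end.

Definition decompressor := bits -> bits -> option bits.  (* program, condition *)

Definition computable_decomp (D : decompressor) : Prop :=
  exists t : mrec, forall p y z,
    D p y = Some z <-> eval t [enc p; enc y] (enc z).

Definition optimal (D : decompressor) : Prop :=
  computable_decomp D /\
  forall D' : decompressor, computable_decomp D' ->
    exists c : nat, forall p y x, D' p y = Some x ->
      exists q, D q y = Some x /\ length q <= length p + c.

Definition KS_spec (D : decompressor) (x y : bits) (k : nat) : Prop :=
  (exists p, D p y = Some x /\ length p = k) /\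
  (forall p, D p y = Some x -> k <= length p).

Definition KS (D : decompressor) (x y : bits) : nat :=
  epsilon (inhabits 0) (KS_spec D x y).

(** encoding of a pair <v,w> of strings as a string (self-delimiting v) *)
Definition pair_enc (v w : bits) : bits :=
  flat_map (fun b => [b; b]) v ++ [false; true] ++ w.

Definition KS2 (D : decompressor) (x v w : bits) : nat := KS D x (pair_enc v w).

(* Main.v *)
(** Let [f] code the table of a function [F] with [F a = b]. Then [b] is computed from
    [a] and [f], and from [f] and a program producing [a] or [b] from [c], so only the
    lower bound on [KS(b|c,f)] restricts [F].

    Call a pair [(x, y)] bad if every table [F] with [F x = y] has [y] in the set [S_F]
    of strings produced from [(c, F)] by programs shorter than [m]. Bad pairs can be
    enumerated given [c], [m] and [N]; a pair is selected when neither component occurs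
    in a previously selected pair. The selected pairs form a matching, so some table [F]
    extends them all and [S_F] contains all their right components: there are at most
    [2^m] of them. If [(a, b)] is bad then [a] or [b] occurs in a selected pair, hence
    has complexity at most [m + O(log N)] given [c]. For [m] slightly below
    [min (KS(a|c)) (KS(b|c))] this is impossible, so [(a, b)] is not bad. *)

Require Import Defs.
From Stdlib Require Import List Arith PeanoNat Lia ClassicalEpsilon Bool.
Import ListNotations.

(** * Total computable functions of fixed arity *)

(** Agreement is asked only on lists of length [n]; what [t] does on other lengths is left free. *)
Definition comp (n : nat) (f : list nat -> nat) : Prop :=
  exists t, forall l, length l = n -> eval t l (f l).

Definition compb (n : nat) (P : list nat -> bool) : Prop :=
  comp n (fun l => Nat.b2n (P l)).

Lemma comp_ext n f g :
  (forall l, length l = n -> f l = g l) -> comp n f -> comp n g.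
Proof.
  intros E [t Ht]. exists t. intros l Hl. rewrite <- E by assumption. auto.
Qed.

Lemma comp_nth n i : comp n (fun l => nth i l 0).
Proof. exists (MProj i). intros; constructor. Qed.

Lemma comp_hd n : comp n (fun l => hd 0 l).
Proof.
  apply comp_ext with (f := fun l => nth 0 l 0); [|apply comp_nth].
  intros [|x l]; reflexivity.
Qed.

Lemma comp_list n k F (gs : list (list nat -> nat)) :
  comp k F -> length gs = k -> Forall (comp n) gs ->
  comp n (fun l => F (map (fun g => g l) gs)).
Proof.
  intros [tF HF] Hk Hgs.
  assert (exists ts, forall l, length l = n -> evals ts l (map (fun g => g l) gs))
    as [ts Hts].
  { clear Hk. induction Hgs as [|g gs [t Ht] _ [ts Hts]].
    - exists []. intros; constructor.
    - exists (t :: ts). intros l Hl; simpl; constructor; auto. }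
  exists (MComp tF ts). intros l Hl. econstructor; [eauto|].
  apply HF. now rewrite length_map.
Qed.

Lemma map_nth_seq (l1 l2 : list nat) :
  map (fun i => nth i (l1 ++ l2) 0) (seq (length l1) (length l2)) = l2.
Proof.
  revert l1. induction l2 as [|y l2 IH]; intros l1; simpl; [reflexivity|].
  rewrite app_nth2, Nat.sub_diag by lia. simpl. f_equal.
  specialize (IH (l1 ++ [y])). rewrite length_app in IH. simpl in IH.
  now rewrite <- app_assoc, Nat.add_1_r in IH.
Qed.

Definition args (k n : nat) : list (list nat -> nat) :=
  map (fun i l => nth i l 0) (seq k n).

Lemma args_app l1 l2 :
  map (fun g => g (l1 ++ l2)) (args (length l1) (length l2)) = l2.
Proof. unfold args. rewrite map_map. apply map_nth_seq. Qed.

Lemma comp_args n k m : Forall (comp n) (args k m).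
Proof. apply Forall_map, Forall_forall. intros i _. apply comp_nth. Qed.

Lemma length_args k n : length (args k n) = n.
Proof. unfold args. now rewrite length_map, length_seq. Qed.

Lemma comp_tl n f : comp n f -> comp (S n) (fun l => f (tl l)).
Proof.
  intros Hf.
  apply comp_ext with (f := fun l => f (map (fun g => g l) (args 1 n))).
  - intros [|x l] Hl; [discriminate|]. injection Hl as <-.
    f_equal. apply (args_app [x] l).
  - apply comp_list with (k := n); auto using length_args, comp_args.
Qed.

Lemma comp_cons n f g :
  comp (S n) f -> comp n g -> comp n (fun l => f (g l :: l)).
Proof.
  intros Hf Hg.
  apply comp_ext with (f := fun l => f (map (fun g => g l) (g :: args 0 n))).
  - intros l <-. simpl. do 2 f_equal. apply (args_app [] l).
  - apply comp_list with (k := S n); auto.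
    + simpl. now rewrite length_args.
    + constructor; auto using comp_args.
Qed.

(** A primitive recursion step receives a counter and an accumulator; this serves subterms that read
    the counter but not the accumulator. *)
Lemma comp_skip n g :
  comp (S n) (fun l => g (hd 0 l) (tl l)) ->
  comp (S (S n)) (fun l => g (hd 0 l) (tl (tl l))).
Proof.
  intros Hg.
  apply comp_ext with (f := fun l => (fun l => g (hd 0 l) (tl l))
    (map (fun h => h l) ((fun l => hd 0 l) :: args 2 n))).
  - intros [|x [|y l]] Hl; try discriminate. injection Hl as <-.
    simpl. f_equal. apply (args_app [x; y] l).
  - apply (comp_list (S (S n)) (S n) (fun l => g (hd 0 l) (tl l))
      ((fun l => hd 0 l) :: args 2 n)); auto.
    + simpl. now rewrite length_args.
    + constructor; auto using comp_args, comp_hd.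
Qed.

(** [MPrec] recurses on its first argument, so [comp_cons] feeds it the computed bound [h l].
    Recursive functions below are rewritten with [nat_rect] to fit this form. *)
Lemma comp_rec n f (g : nat -> nat -> list nat -> nat) h :
  comp n f -> comp (S (S n)) (fun l => g (hd 0 l) (hd 0 (tl l)) (tl (tl l))) ->
  comp n h ->
  comp n (fun l => nat_rect (fun _ => nat) (f l) (fun k r => g k r l) (h l)).
Proof.
  intros [tf Hf] [tg Hg] Hh.
  apply (comp_cons n (fun l => nat_rect (fun _ => nat) (f (tl l))
    (fun k r => g k r (tl l)) (hd 0 l)) h); auto.
  exists (MPrec tf tg). intros [|k l] Hl; [discriminate|]. injection Hl as Hl. simpl.
  induction k as [|k IH]; simpl.
  - constructor. auto.
  - econstructor; [exact IH|].
    apply (Hg (k :: _ :: l)). simpl. congruence.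
Qed.

Lemma comp_const n c : comp n (fun _ => c).
Proof.
  induction c as [|c [t Ht]].
  - exists MZero. intros; constructor.
  - exists (MComp MSucc [t]). intros l Hl. econstructor.
    + constructor; [apply Ht, Hl | constructor].
    + apply (ev_succ [c]).
Qed.

Lemma comp_S n f : comp n f -> comp n (fun l => S (f l)).
Proof.
  intros [t Ht]. exists (MComp MSucc [t]). intros l Hl. econstructor.
  - constructor; [apply Ht, Hl | constructor].
  - apply (ev_succ [f l]).
Qed.

Ltac comp_step :=
  lazymatch goal with
  | H : comp ?n ?f |- comp ?n ?f => exact H
  | H : compb ?n ?P |- compb ?n ?P => exact H
  | |- comp _ (hd 0) => apply comp_hd
  | |- comp _ (fun l => hd 0 l) => apply comp_hd
  | |- comp _ (fun l => nth _ l 0) => apply comp_nth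
  | |- comp _ (fun l => nth ?i (tl l) 0) => apply (comp_tl _ (fun l => nth i l 0))
  | |- comp _ (fun l => ?g (tl (tl l))) => apply (comp_tl _ (fun l => g (tl l)))
  | |- comp _ (fun l => ?g (tl l)) => apply (comp_tl _ g)
  | |- comp ?n (fun l => Nat.b2n (@?P l)) => change (compb n P)
  | |- comp _ (fun _ => ?c) => apply comp_const
  | |- compb _ (fun _ => ?b) => apply (comp_const _ (Nat.b2n b))
  | |- comp _ (fun l => S _) => apply comp_S
  end.
Ltac comp_solve := repeat (comp_step; cbv beta).

Lemma comp_case n f (g : nat -> list nat -> nat) h :
  comp n h -> comp n f -> comp (S n) (fun l => g (hd 0 l) (tl l)) ->
  comp n (fun l => match h l with 0 => f l | S k => g k l end).
Proof.
  intros Hh Hf Hg.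
  apply comp_ext with (f := fun l =>
    nat_rect (fun _ => nat) (f l) (fun k r => g k l) (h l)).
  - intros l _. now destruct (h l).
  - apply (comp_rec n f (fun k _ l => g k l)); auto.
    now apply comp_skip.
Qed.

Lemma comp_if n P f g :
  compb n P -> comp n f -> comp n g -> comp n (fun l => if P l then f l else g l).
Proof.
  intros HP Hf Hg.
  apply comp_ext with (f := fun l => match Nat.b2n (P l) with 0 => g l | S _ => f l end).
  - intros l _. now destruct (P l).
  - apply (comp_case n g (fun _ => f)); auto. now apply comp_tl.
Qed.

Lemma comp_add n f g : comp n f -> comp n g -> comp n (fun l => f l + g l).
Proof.
  intros Hf Hg.
  apply comp_ext with (f := fun l =>
    nat_rect (fun _ => nat) (g l) (fun _ r => S r) (f l)).
  - intros l _. induction (f l); simpl; auto.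
  - apply (comp_rec n g (fun _ r _ => S r)); comp_solve.
Qed.

Lemma comp_pred n f : comp n f -> comp n (fun l => pred (f l)).
Proof.
  intros Hf. apply (comp_case n f (fun k _ => k) f); comp_solve.
Qed.

Lemma comp_sub n f g : comp n f -> comp n g -> comp n (fun l => f l - g l).
Proof.
  intros Hf Hg.
  apply comp_ext with (f := fun l =>
    nat_rect (fun _ => nat) (f l) (fun _ r => pred r) (g l)).
  - intros l _. induction (g l); simpl; [apply eq_sym, Nat.sub_0_r|lia].
  - apply (comp_rec n f (fun _ r _ => pred r)); comp_solve.
    apply comp_pred; comp_solve.
Qed.

Lemma comp_mul n f g : comp n f -> comp n g -> comp n (fun l => f l * g l).
Proof.
  intros Hf Hg.
  apply comp_ext with (f := fun l =>
    nat_rect (fun _ => nat) 0 (fun _ r => g l + r) (f l)).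
  - intros l _. induction (f l); simpl; auto.
  - apply (comp_rec n (fun _ => 0) (fun _ r l => g l + r)); comp_solve.
    apply comp_add; comp_solve.
Qed.

Lemma comp_pow n f g : comp n f -> comp n g -> comp n (fun l => f l ^ g l).
Proof.
  intros Hf Hg.
  apply comp_ext with (f := fun l =>
    nat_rect (fun _ => nat) 1 (fun _ r => f l * r) (g l)).
  - intros l _. induction (g l); simpl; auto.
  - apply (comp_rec n (fun _ => 1) (fun _ r l => f l * r)); comp_solve.
    apply comp_mul; comp_solve.
Qed.

Lemma compb_ext n P Q :
  (forall l, length l = n -> P l = Q l) -> compb n P -> compb n Q.
Proof. intros E. apply comp_ext. intros l Hl. now rewrite E. Qed.

Lemma compb_and n P Q : compb n P -> compb n Q -> compb n (fun l => P l && Q l).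
Proof.
  intros HP HQ.
  apply comp_ext with (f := fun l => if P l then Nat.b2n (Q l) else 0).
  - intros l _. now destruct (P l).
  - apply comp_if; comp_solve.
Qed.

Lemma compb_not n P : compb n P -> compb n (fun l => negb (P l)).
Proof.
  intros HP.
  apply comp_ext with (f := fun l => if P l then 0 else 1).
  - intros l _. now destruct (P l).
  - apply comp_if; comp_solve.
Qed.

Lemma compb_leb n f g : comp n f -> comp n g -> compb n (fun l => f l <=? g l).
Proof.
  intros Hf Hg.
  apply comp_ext with (f := fun l => match f l - g l with 0 => 1 | S _ => 0 end).
  - intros l _. destruct (Nat.leb_spec (f l) (g l)); destruct (f l - g l) eqn:E; simpl; lia.
  - apply (comp_case n (fun _ => 1) (fun _ _ => 0) (fun l => f l - g l)); comp_solve.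
    now apply comp_sub.
Qed.

Lemma compb_ltb n f g : comp n f -> comp n g -> compb n (fun l => f l <? g l).
Proof. intros Hf Hg. apply (compb_leb n (fun l => S (f l))); comp_solve. Qed.

Lemma compb_eqb n f g : comp n f -> comp n g -> compb n (fun l => f l =? g l).
Proof.
  intros Hf Hg.
  apply compb_ext with (P := fun l => (f l <=? g l) && (g l <=? f l)).
  - intros l _.
    destruct (Nat.leb_spec (f l) (g l)), (Nat.leb_spec (g l) (f l)),
      (Nat.eqb_spec (f l) (g l)); simpl; lia.
  - apply compb_and; now apply compb_leb.
Qed.

(** * Bounded quantifiers and bounded minimisation *)

Fixpoint ball (n : nat) (P : nat -> bool) : bool :=
  match n with 0 => true | S k => ball k P && P k end.

Lemma ball_spec n P : ball n P = true <-> forall i, i < n -> P i = true.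
Proof.
  induction n as [|n IH]; simpl.
  - split; [lia|auto].
  - rewrite andb_true_iff, IH. split.
    + intros [H1 H2] i Hi. destruct (Nat.eq_dec i n) as [->|]; [auto|apply H1; lia].
    + intros H. split; [intros; apply H; lia|apply H; lia].
Qed.

Definition bex (n : nat) (P : nat -> bool) : bool := negb (ball n (fun i => negb (P i))).

Lemma bex_spec n P : bex n P = true <-> exists i, i < n /\ P i = true.
Proof.
  unfold bex. rewrite negb_true_iff. split.
  - intros H. apply NNPP. intros H'.
    assert (ball n (fun i => negb (P i)) = true); [|congruence].
    apply ball_spec. intros i Hi. destruct (P i) eqn:E; [|reflexivity].
    exfalso. eauto.
  - intros (i & Hi & Hp). destruct (ball n _) eqn:E; [|reflexivity].
    rewrite ball_spec in E. specialize (E i Hi). now rewrite Hp in E.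
Qed.

(** In the recursion [r < k] means that a witness was already found, and [r = k] that there is none
    below [k]. Without any witness the value is [n]. *)
Fixpoint bmin (n : nat) (P : nat -> bool) : nat :=
  match n with
  | 0 => 0
  | S k => let r := bmin k P in if r <? k then r else if P k then k else S k
  end.

Lemma bmin_least n P i :
  i < n -> P i = true -> (forall j, j < i -> P j = false) -> bmin n P = i.
Proof.
  intros Hi HP Hj.
  assert (Hs : forall k, k <= i -> bmin k P = k).
  { induction k as [|k IH]; [reflexivity|]. intros Hk. simpl.
    rewrite IH, Nat.ltb_irrefl, Hj by lia. reflexivity. }
  induction n as [|n IH]; [lia|]. simpl.
  destruct (Nat.eq_dec i n) as [->|].
  - now rewrite Hs, Nat.ltb_irrefl, HP by lia.
  - rewrite IH by lia. destruct (Nat.ltb_spec i n); [reflexivity|lia].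
Qed.

Lemma compb_ball n f (P : nat -> list nat -> bool) :
  comp n f -> compb (S n) (fun l => P (hd 0 l) (tl l)) ->
  compb n (fun l => ball (f l) (fun i => P i l)).
Proof.
  intros Hf HP.
  apply comp_ext with (f := fun l =>
    nat_rect (fun _ => nat) 1 (fun k r => if r =? 1 then Nat.b2n (P k l) else 0) (f l)).
  - intros l _. induction (f l) as [|k IH]; simpl; [reflexivity|].
    rewrite IH. destruct (ball _ _); simpl; reflexivity.
  - apply (comp_rec n (fun _ => 1)
      (fun k r l => if r =? 1 then Nat.b2n (P k l) else 0)); comp_solve.
    apply comp_if; comp_solve.
    + apply compb_eqb; comp_solve.
    + now apply (comp_skip n (fun k l => Nat.b2n (P k l))).
Qed.

Lemma compb_bex n f (P : nat -> list nat -> bool) :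
  comp n f -> compb (S n) (fun l => P (hd 0 l) (tl l)) ->
  compb n (fun l => bex (f l) (fun i => P i l)).
Proof.
  intros Hf HP. apply compb_not, (compb_ball n f (fun i l => negb (P i l))); auto.
  now apply compb_not.
Qed.

Lemma comp_bmin n f (P : nat -> list nat -> bool) :
  comp n f -> compb (S n) (fun l => P (hd 0 l) (tl l)) ->
  comp n (fun l => bmin (f l) (fun i => P i l)).
Proof.
  intros Hf HP.
  apply comp_ext with (f := fun l =>
    nat_rect (fun _ => nat) 0
      (fun k r => if r <? k then r else if P k l then k else S k) (f l)).
  - intros l _. induction (f l) as [|k IH]; simpl; [reflexivity|]. now rewrite IH.
  - apply (comp_rec n (fun _ => 0)
      (fun k r l => if r <? k then r else if P k l then k else S k)); comp_solve.
    apply comp_if; comp_solve; [apply compb_ltb; comp_solve|].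
    apply comp_if; comp_solve.
    now apply (comp_skip n (fun k l => Nat.b2n (P k l))).
Qed.

(* Hook redefined as further functions are shown computable. *)
Ltac comp_defined := fail.
Ltac comp_arith :=
  first [ comp_step
        | comp_defined
        | lazymatch goal with
          | |- comp _ (fun l => _ + _) => apply comp_add
          | |- comp _ (fun l => _ - _) => apply comp_sub
          | |- comp _ (fun l => _ * _) => apply comp_mul
          | |- comp _ (fun l => _ ^ _) => apply comp_pow
          | |- comp _ (fun l => pred _) => apply comp_pred
          | |- comp _ (fun l => if _ then _ else _) => apply comp_if
          | |- compb _ (fun l => _ && _) => apply compb_and
          | |- compb _ (fun l => negb _) => apply compb_not
          | |- compb _ (fun l => _ <? _) => apply compb_ltb
          | |- compb _ (fun l => _ =? _) => apply compb_eqb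
          | |- compb ?n (fun l => ball (@?f l) (fun i => @?P l i)) =>
              apply (compb_ball n f (fun i l => P l i))
          | |- compb ?n (fun l => bex (@?f l) (fun i => @?P l i)) =>
              apply (compb_bex n f (fun i l => P l i))
          | |- comp ?n (fun l => bmin (@?f l) (fun i => @?P l i)) =>
              apply (comp_bmin n f (fun i l => P l i))
          | |- comp ?n (fun l => nat_rect _ (@?f l) (fun k r => @?g l k r) (@?h l)) =>
              apply (comp_rec n f (fun k r l => g l k r) h)
          end ].
Ltac comp_auto := cbv beta; repeat (comp_arith; cbv beta).

Lemma comp_div n f g : comp n f -> comp n g -> comp n (fun l => f l / g l).
Proof.
  intros Hf Hg.
  (* The quotient is the least [q] with [f l < g l * S q]; division by zero gives [0] by
     convention. *)
  apply comp_ext with (f := fun l =>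
    if g l =? 0 then 0 else bmin (S (f l)) (fun q => f l <? g l * S q)).
  - intros l _. destruct (Nat.eqb_spec (g l) 0) as [->|H]; [reflexivity|].
    apply bmin_least.
    + apply Nat.lt_succ_r, Nat.Div0.div_le_upper_bound. nia.
    + apply Nat.ltb_lt, Nat.mul_succ_div_gt, H.
    + intros j Hj. apply Nat.ltb_ge.
      transitivity (g l * (f l / g l)); [nia|apply Nat.Div0.mul_div_le].
  - comp_auto.
Qed.

Lemma comp_mod n f g : comp n f -> comp n g -> comp n (fun l => f l mod g l).
Proof.
  intros Hf Hg.
  apply comp_ext with (f := fun l => f l - g l * (f l / g l)).
  - intros l _. symmetry. apply Nat.Div0.mod_eq.
  - comp_auto; now apply comp_div.
Qed.

Lemma comp_log2 n f : comp n f -> comp n (fun l => Nat.log2 (f l)).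
Proof.
  intros Hf.
  apply comp_ext with (f := fun l => bmin (f l) (fun i => f l <? 2 ^ S i)).
  - intros l _. destruct (Nat.eq_dec (f l) 0) as [->|H]; [reflexivity|].
    apply bmin_least.
    + apply Nat.log2_lt_lin. lia.
    + apply Nat.ltb_lt, Nat.log2_spec. lia.
    + intros j Hj. apply Nat.ltb_ge, Nat.log2_le_pow2; lia.
  - comp_auto.
Qed.

Ltac comp_defined ::=
  lazymatch goal with
  | |- comp _ (fun l => _ / _) => apply comp_div
  | |- comp _ (fun l => _ mod _) => apply comp_mod
  | |- comp _ (fun l => Nat.log2 _) => apply comp_log2
  end.

(** * Step-bounded evaluation *)

(** The list nested in [MComp] calls for an induction principle with a hypothesis for each of its
    members. *)
Lemma mrec_list_ind (P : mrec -> Prop) :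
  P MZero -> P MSucc -> (forall i, P (MProj i)) ->
  (forall f gs, P f -> Forall P gs -> P (MComp f gs)) ->
  (forall f g, P f -> P g -> P (MPrec f g)) ->
  (forall f, P f -> P (MMu f)) -> forall t, P t.
Proof.
  intros H0 HS Hp Hc Hr Hm. fix IH 1. intros [| |i|f gs|f g|f].
  - exact H0.
  - exact HS.
  - apply Hp.
  - apply Hc; [apply IH|]. induction gs; constructor; auto.
  - apply Hr; apply IH.
  - apply Hm, IH.
Qed.

(** [f i] is an optional value: [0] for none, [1] for the value zero. As [ev_mu] demands, an
    undefined value met before the first zero aborts the search; the outer [pred] merges the two
    kinds of failure. *)
Definition search (s : nat) (f : nat -> nat) : nat :=
  pred (nat_rect (fun _ => nat) 0 (fun i st =>
    if st =? 0 then
      if f i =? 0 then 1 else if f i =? 1 then S (S i) else 0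
    else st) s).

(** [run s t xs] is [0] if [t] does not halt on [xs] within [s] search steps per
    minimisation, and [S v] if it returns [v]; in the accumulator of [search], [0]
    stands for "keep searching", [1] for "undefined" and [S (S i)] for "found [i]". *)
Fixpoint run (s : nat) (t : mrec) (xs : list nat) : nat :=
  match t with
  | MZero => 1
  | MSucc => S (S (hd 0 xs))
  | MProj i => S (nth i xs 0)
  | MComp f gs =>
      let vs := map (fun g => run s g xs) gs in
      if forallb (fun v => negb (v =? 0)) vs then run s f (map pred vs) else 0
  | MPrec f g =>
      match xs with
      | [] => 0
      | n :: l => nat_rect (fun _ => nat) (run s f l)
          (fun k r => if r =? 0 then 0 else run s g (k :: pred r :: l)) n
      end
  | MMu f => search s (fun i => run s f (i :: xs))
  end.

Lemma search_spec s f n :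
  search s f = S n <->
  n < s /\ f n = 1 /\ forall m, m < n -> exists k, f m = S (S k).
Proof.
  unfold search.
  set (st := nat_rect _ _ _).
  (* State [0] is characterised along with success, since it is the only state from which the search
     goes on. *)
  assert (H : forall s,
    (st s = 0 <-> forall m, m < s -> exists k, f m = S (S k)) /\
    forall n, (st s = S (S n) <->
      n < s /\ f n = 1 /\ forall m, m < n -> exists k, f m = S (S k))).
  { clear s n. induction s as [|s [IH0 IHS]].
    - simpl. split; [split; [lia|auto]|]. intros n. split; [discriminate|lia].
    - change (st (S s)) with (if st s =? 0 then
        if f s =? 0 then 1 else if f s =? 1 then S (S s) else 0 else st s).
      destruct (Nat.eqb_spec (st s) 0) as [E|E].
      + pose proof (proj1 IH0 E) as Hs.
        assert (Hn : forall n, n < S s -> f n = 1 -> n = s).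
        { intros n Hn H1. destruct (Nat.eq_dec n s); auto.
          destruct (Hs n) as [k Hk]; [lia|congruence]. }
        destruct (f s) as [|[|k]] eqn:Ef; simpl.
        * split.
          -- split; [discriminate|]. intros H. destruct (H s); [lia|congruence].
          -- intros n. split; [discriminate|]. intros (Hl & H1 & _).
             specialize (Hn n Hl H1). congruence.
        * split.
          -- split; [discriminate|]. intros H. destruct (H s); [lia|congruence].
          -- intros n. split.
             ++ intros [= <-]. auto.
             ++ intros (Hl & H1 & _). f_equal. f_equal. symmetry. auto.
        * split.
          -- split; [|auto]. intros _ m Hm.
             destruct (Nat.eq_dec m s) as [->|]; [eauto|apply Hs; lia].
          -- intros n. split; [discriminate|]. intros (Hl & H1 & _).
             specialize (Hn n Hl H1). congruence.
      + split.
        * split; [congruence|]. intros H. exfalso. apply E, IH0. intros; apply H; lia.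
        * intros n. rewrite IHS. split; intros (Hl & H1 & H2).
          -- split; [lia|auto].
          -- split; [|auto]. destruct (Nat.eq_dec n s) as [->|]; [|lia].
             exfalso. apply E, IH0, H2. }
  specialize (H s) as [_ H]. rewrite <- H. destruct (st s) as [|[|k]]; simpl; split; congruence.
Qed.

(** A successful search reads nothing beyond the index it returns, so a longer one returns the same
    index. *)
Lemma run_mono t : forall s s' xs v, s <= s' -> run s t xs = S v -> run s' t xs = S v.
Proof.
  induction t as [| |i|f gs IHf IHgs|f g IHf IHg|f IHf] using mrec_list_ind;
    intros s s' xs v Hs; simpl; auto.
  - assert (forallb (fun v => negb (v =? 0)) (map (fun g => run s g xs) gs) = true ->
      map (fun g => run s' g xs) gs = map (fun g => run s g xs) gs) as E.
    { induction IHgs as [|g gs Hg _ IH]; simpl; [reflexivity|].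
      rewrite andb_true_iff. intros [H1 H2]. f_equal; auto.
      destruct (run s g xs) eqn:Eg; [discriminate|]. eauto. }
    destruct (forallb _ (map (fun g => run s g xs) gs)) eqn:Ef; [|discriminate].
    rewrite E, Ef by reflexivity. eauto.
  - destruct xs as [|n l]; [discriminate|]. revert v.
    induction n as [|n IH]; simpl; intros v; [eauto|].
    destruct (nat_rect _ (run s f l) _ n) as [|r]; [discriminate|].
    rewrite (IH r) by reflexivity. simpl. eauto.
  - rewrite !search_spec. intros (H1 & H2 & H3). repeat split; [lia|eauto|].
    intros m Hm. destruct (H3 m Hm) as [k Hk]. eauto.
Qed.

Lemma map_run_mono gs s s' xs ys : s <= s' ->
  map (fun g => run s g xs) gs = map S ys -> map (fun g => run s' g xs) gs = map S ys.
Proof.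
  intros Hs. revert ys.
  induction gs as [|g gs IH]; intros [|y ys] H; try discriminate; [reflexivity|].
  simpl in *. injection H as H1 H2. f_equal; [|auto].
  now apply run_mono with s.
Qed.

(** Used for the finitely many arguments below a minimum, and later for the finitely many tables on
    which badness depends. *)
Lemma bounded_stage (P : nat -> nat -> Prop) n :
  (forall i s s', s <= s' -> P i s -> P i s') ->
  (forall i, i < n -> exists s, P i s) -> exists s, forall i, i < n -> P i s.
Proof.
  intros Hm. induction n as [|n IH]; intros H.
  - exists 0. lia.
  - destruct IH as [s1 H1]; [auto|]. destruct (H n) as [s2 H2]; [lia|].
    exists (s1 + s2). intros i Hi. destruct (Nat.eq_dec i n) as [->|].
    + apply Hm with s2; [lia|auto].
    + apply Hm with s1; [lia|apply H1; lia].
Qed.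

Lemma run_complete t : forall xs v, eval t xs v -> exists s, run s t xs = S v.
Proof.
  induction t as [| |i|f gs IHf IHgs|f g IHf IHg|f IHf] using mrec_list_ind;
    intros xs v H.
  - inversion H; subst. now exists 0.
  - inversion H; subst. now exists 0.
  - inversion H; subst. now exists 0.
  - inversion H as [| | |? ? ? ys ? Hgs Hf| | |]; subst.
    destruct (IHf _ _ Hf) as [s1 H1].
    assert (exists s2, map (fun g => run s2 g xs) gs = map S ys) as [s2 H2].
    { clear -IHgs Hgs. revert ys Hgs.
      induction IHgs as [|g gs Hg Hgs IH]; intros ys H; inversion H; subst.
      - now exists 0.
      - destruct (Hg xs y) as [s1 Hs1]; [auto|].
        destruct (IH ys0) as [s2 Hs2]; [auto|].
        exists (s1 + s2). simpl. f_equal.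
        + apply run_mono with s1; [lia|auto].
        + apply map_run_mono with s2; [lia|auto]. }
    exists (s1 + s2). simpl.
    rewrite (map_run_mono gs s2 (s1 + s2) xs ys) by (lia || assumption).
    rewrite map_map, map_id.
    replace (forallb _ (map S ys)) with true by (clear; induction ys; auto).
    apply run_mono with s1; [lia|auto].
  - assert (forall n l v, eval (MPrec f g) (n :: l) v ->
      exists s, run s (MPrec f g) (n :: l) = S v) as Hn.
    { clear -IHf IHg. induction n as [|n IH]; intros l v H; inversion H; subst.
      - now apply IHf.
      - destruct (IH l y) as [s1 Hs1]; [auto|].
        destruct (IHg (n :: y :: l) v) as [s2 Hs2]; [auto|].
        exists (s1 + s2).
        apply run_mono with (s' := s1 + s2) in Hs1; [|lia].
        apply run_mono with (s' := s1 + s2) in Hs2; [|lia].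
        simpl in *. rewrite Hs1. exact Hs2. }
    destruct xs as [|n l]; [inversion H|auto].
  - inversion H as [| | | | | |? ? ? H1 H2]; subst.
    destruct (IHf _ _ H1) as [s1 Hs1].
    destruct (bounded_stage (fun m s => exists k, run s f (m :: xs) = S (S k)) v) as [s2 Hs2].
    + intros i s s' Hs [k Hk]. exists k. now apply run_mono with s.
    + intros m Hm. destruct (H2 m Hm) as [k Hk]. destruct (IHf _ _ Hk). eauto.
    (* The summand [S v] is there because a search of [s] steps only reaches indices below [s]. *)
    + exists (S v + s1 + s2). simpl run. apply search_spec. repeat split; [lia| |].
      * apply run_mono with s1; [lia|auto].
      * intros m Hm. destruct (Hs2 m Hm) as [k Hk]. exists k.
        apply run_mono with s2; [lia|auto].
Qed.

Lemma run_sound t : forall s xs v, run s t xs = S v -> eval t xs v.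
Proof.
  induction t as [| |i|f gs IHf IHgs|f g IHf IHg|f IHf] using mrec_list_ind;
    intros s xs v; simpl.
  - intros [= <-]. constructor.
  - intros [= <-]. constructor.
  - intros [= <-]. constructor.
  - destruct (forallb _ _) eqn:E; [|discriminate]. intros H.
    apply ev_comp with (map pred (map (fun g => run s g xs) gs)); [|eauto].
    clear H. induction IHgs as [|g gs Hg _ IH]; simpl in *; constructor.
    + destruct (run s g xs) eqn:Eg; [discriminate|]. eauto.
    + apply IH. destruct (run s g xs); [discriminate|auto].
  - destruct xs as [|n l]; [discriminate|]. revert v.
    induction n as [|n IH]; simpl; intros v H.
    + constructor. eauto.
    + destruct (nat_rect _ (run s f l) _ n) as [|r]; [discriminate|].
      apply ev_precS with r; [now apply IH|]. now apply IHg with s.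
  - rewrite search_spec. intros (_ & H1 & H2). constructor; [eauto|].
    intros m Hm. destruct (H2 m Hm). eauto.
Qed.

Lemma eval_run t xs v : eval t xs v <-> exists s, run s t xs = S v.
Proof.
  split; [apply run_complete|]. intros [s H]. now apply run_sound with s.
Qed.

(** Determinism is read off the interpreter: both values appear at stage [s + s']. *)
Lemma eval_fun t xs v w : eval t xs v -> eval t xs w -> v = w.
Proof.
  rewrite !eval_run. intros [s Hs] [s' Hs'].
  apply run_mono with (s' := s + s') in Hs, Hs'; [congruence|lia|lia].
Qed.

Lemma comp_search n (f : nat -> list nat -> nat) h :
  comp n h -> comp (S n) (fun l => f (hd 0 l) (tl l)) ->
  comp n (fun l => search (h l) (fun i => f i l)).
Proof.
  intros Hh Hf. unfold search. apply comp_pred.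
  apply (comp_rec n (fun _ => 0) (fun i st l =>
    if st =? 0 then if f i l =? 0 then 1 else if f i l =? 1 then S (S i) else 0 else st));
    comp_auto; now apply (comp_skip n f).
Qed.

(** Induction on the fixed term [t] builds one interpreter per [t], with the stage and the inputs as
    its arguments. *)
Lemma comp_run_stage t : forall n, comp (S n) (fun l => run (hd 0 l) t (tl l)).
Proof.
  induction t as [| |i|f gs IHf IHgs|f g IHf IHg|f IHf] using mrec_list_ind; intros n;
    cbn [run].
  - comp_auto.
  - comp_auto.
  - comp_auto.
  - apply comp_if.
    + induction IHgs as [|g gs Hg _ IH]; simpl; comp_auto; auto.
    + apply comp_ext with (f := fun l => (fun l => run (hd 0 l) f (tl l))
        (map (fun g => g l) ((fun l => hd 0 l) ::
           map (fun g l => pred (run (hd 0 l) g (tl l))) gs))).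
      * intros l _. simpl. now rewrite !map_map.
      * apply (comp_list (S n) (S (length gs)) (fun l => run (hd 0 l) f (tl l))); auto.
        -- simpl. now rewrite length_map.
        -- constructor; [apply comp_hd|]. apply Forall_map.
           revert IHgs. apply Forall_impl. intros g Hg. comp_auto. auto.
    + comp_auto.
  - destruct n as [|n].
    { apply comp_ext with (f := fun _ => 0); [|comp_auto].
      intros [|x [|y l]] Hl; try discriminate. reflexivity. }
    apply comp_ext with (f := fun l =>
      nat_rect (fun _ => nat) (run (hd 0 l) f (tl (tl l)))
        (fun k r => if r =? 0 then 0 else run (hd 0 l) g (k :: pred r :: tl (tl l)))
        (hd 0 (tl l))).
    { intros [|x [|y l]] Hl; try discriminate. reflexivity. }
    apply (comp_rec (S (S n)) (fun l => run (hd 0 l) f (tl (tl l)))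
      (fun k r l => if r =? 0 then 0 else run (hd 0 l) g (k :: pred r :: tl (tl l))));
      comp_auto.
    + apply (comp_skip n (fun s l => run s f l)), IHf.
    (* The recursion step sees counter, accumulator, stage, bound and parameters; [g] is run on
       stage, counter, decoded accumulator and parameters. *)
    + apply comp_ext with (f := fun l => (fun l => run (hd 0 l) g (tl l))
        (map (fun h => h l) ((fun l => hd 0 (tl (tl l))) :: (fun l => hd 0 l) ::
           (fun l => pred (hd 0 (tl l))) :: args 4 n))).
      * intros [|k [|r [|x [|y l]]]] Hl; try discriminate. injection Hl as <-. simpl.
        do 3 f_equal. apply (args_app [k; r; x; y] l).
      * apply (comp_list _ (S (S (S n))) (fun l => run (hd 0 l) g (tl l))); auto.
        -- simpl. now rewrite length_args.
        -- repeat (constructor; [comp_auto|]). apply comp_args.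
  - apply (comp_search (S n) (fun i l => run (hd 0 l) f (i :: tl l))); comp_auto.
    apply comp_ext with (f := fun l => (fun l => run (hd 0 l) f (tl l))
      (map (fun h => h l) ((fun l => hd 0 (tl l)) :: (fun l => hd 0 l) :: args 2 n))).
    + intros [|x [|y l]] Hl; try discriminate. injection Hl as <-. simpl.
      do 2 f_equal. apply (args_app [x; y] l).
    + apply (comp_list _ (S (S n)) (fun l => run (hd 0 l) f (tl l))); auto.
      * simpl. now rewrite length_args.
      * repeat (constructor; [comp_auto|]). apply comp_args.
Qed.

Lemma comp_run n t s p y :
  comp n s -> comp n p -> comp n y -> comp n (fun l => run (s l) t [p l; y l]).
Proof.
  intros Hs Hp Hy.
  apply (comp_list n 3 (fun l => run (hd 0 l) t (tl l)) [s; p; y]); auto.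
  apply comp_run_stage.
Qed.

(** * Upper bounds on complexity *)

Lemma enc_pos s : 0 < enc s.
Proof. induction s; simpl; lia. Qed.

Lemma enc_inj s : forall s', enc s = enc s' -> s = s'.
Proof.
  induction s as [|b s IH]; intros [|b' s']; simpl; intros H; auto.
  - pose proof (enc_pos s'). destruct b'; lia.
  - pose proof (enc_pos s). destruct b; lia.
  - assert (enc s = enc s' /\ b = b') as [E ->] by (destruct b, b'; split; auto; lia).
    f_equal. auto.
Qed.

Lemma enc_surj n : 0 < n -> exists s, enc s = n.
Proof.
  induction n as [n IH] using lt_wf_ind. intros Hn.
  destruct (Nat.eq_dec n 1) as [->|H]; [now exists []|].
  destruct (IH (n / 2)) as [s Hs].
  - apply Nat.div_lt; lia.
  - apply Nat.div_str_pos; lia.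
  - exists ((n mod 2 =? 1) :: s). cbn [enc]. rewrite Hs.
    pose proof (Nat.div_mod_eq n 2). pose proof (Nat.mod_upper_bound n 2 ltac:(lia)).
    destruct (Nat.eqb_spec (n mod 2) 1); lia.
Qed.

Lemma enc_bounds s : 2 ^ length s <= enc s < 2 ^ S (length s).
Proof.
  induction s as [|b s IH]; [simpl; lia|]. cbn [length enc].
  rewrite !Nat.pow_succ_r' in *. destruct b; lia.
Qed.

Lemma log2_enc s : Nat.log2 (enc s) = length s.
Proof. apply Nat.log2_unique; [lia|apply enc_bounds]. Qed.

(** Classical choice turns the partial function of [t] into an option-valued one. An output [0]
    codes no string and counts as undefined. *)
Definition decompressor_of (t : mrec) : decompressor := fun p y =>
  match excluded_middle_informative (exists z, eval t [enc p; enc y] (enc z)) with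
  | left H => Some (proj1_sig (constructive_indefinite_description _ H))
  | right _ => None
  end.

Lemma decompressor_of_spec t p y z :
  decompressor_of t p y = Some z <-> eval t [enc p; enc y] (enc z).
Proof.
  unfold decompressor_of. destruct excluded_middle_informative as [H|H].
  - destruct constructive_indefinite_description as [x Hx]. simpl. split.
    + now intros [= <-].
    + intros Hz. f_equal. apply enc_inj. now apply eval_fun with (1 := Hx).
  - split; [discriminate|]. intros Hz. exfalso. eauto.
Qed.

Lemma KS_correct D p x y : D p y = Some x -> KS_spec D x y (KS D x y).
Proof.
  intros H. unfold KS. apply epsilon_spec.
  destruct (dec_inh_nat_subset_has_unique_least_element
    (fun k => exists p, D p y = Some x /\ length p = k)) as (k & (Hk & Hl) & _).
  - intros k. apply classic.
  - eauto.
  - exists k. split; [exact Hk|]. intros q Hq. apply Hl. eauto.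
Qed.

Lemma KS_le_length D p x y : D p y = Some x -> KS D x y <= length p.
Proof. intros H. exact (proj2 (KS_correct D p x y H) p H). Qed.

(** All upper bounds on [KS] come from here. [Q s p y] is the total, stage-by-stage form of a
    machine; searching for its first successful stage gives a decompressor, which optimality
    simulates at constant cost. *)
Lemma optimal_bound D (HD : optimal D) (Q : nat -> nat -> nat -> nat) :
  comp 3 (fun l => Q (nth 0 l 0) (nth 1 l 0) (nth 2 l 0)) ->
  exists C, forall p y x s,
    Q s (enc p) (enc y) = S (enc x) ->
    (forall s' z, Q s' (enc p) (enc y) = S z -> z = enc x) ->
    KS_spec D x y (KS D x y) /\ KS D x y <= length p + C.
Proof.
  intros HQ. destruct HD as [_ HD].
  (* [t1] vanishes exactly at the successful stages, so [MMu t1] finds the first one, and [t2] reads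
     off the output there. *)
  assert (comp 3 (fun l => if Q (nth 0 l 0) (nth 1 l 0) (nth 2 l 0) =? 0 then 1 else 0))
    as [t1 H1] by (comp_auto; exact HQ).
  assert (comp 3 (fun l => pred (Q (nth 0 l 0) (nth 1 l 0) (nth 2 l 0))))
    as [t2 H2] by (apply comp_pred; exact HQ).
  set (t := MComp t2 [MMu t1; MProj 0; MProj 1]).
  destruct (HD (decompressor_of t)) as [C HC].
  { exists t. apply decompressor_of_spec. }
  exists C. intros p y x s Hs Hu.
  enough (decompressor_of t p y = Some x) as H.
  { destruct (HC p y x H) as (q & Hq & Hl). split; [now apply KS_correct with q|].
    apply KS_le_length in Hq. lia. }
  apply decompressor_of_spec.
  destruct (dec_inh_nat_subset_has_unique_least_element
    (fun s => exists z, Q s (enc p) (enc y) = S z)) as (k & ((z & Hk) & Hl) & _).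
  { intros k. apply classic. }
  { eauto. }
  assert (z = enc x) as -> by eauto.
  apply ev_comp with [k; enc p; enc y].
  - repeat constructor.
    + specialize (H1 [k; enc p; enc y] eq_refl). simpl in H1. now rewrite Hk in H1.
    + intros m Hm. exists 0. specialize (H1 [m; enc p; enc y] eq_refl). simpl in H1.
      destruct (Q m (enc p) (enc y)) eqn:E; [exact H1|].
      specialize (Hl m (ex_intro _ _ E)). lia.
  - specialize (H2 [k; enc p; enc y] eq_refl). simpl in H2. now rewrite Hk in H2.
Qed.

(** * Codes of pairs and tables *)

(** This is [pair_enc] on codes: [4 * w + 2] puts the separator before [w], and each round prepends
    a doubled bit of [v], last bit first. *)
Definition pcode (v w : nat) : nat :=
  nat_rect (fun _ => nat) (4 * w + 2)
    (fun i r => 4 * r + 3 * ((v / 2 ^ (Nat.log2 v - S i)) mod 2)) (Nat.log2 v).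

Lemma pcode_enc v w : pcode (enc v) (enc w) = enc (pair_enc v w).
Proof.
  unfold pcode. rewrite log2_enc.
  induction v as [|b v IH]; [simpl; lia|].
  cbn [length nat_rect]. rewrite Nat.sub_diag, Nat.pow_0_r, Nat.div_1_r.
  transitivity (4 * enc (pair_enc v w) + 3 * (enc (b :: v) mod 2)).
  - f_equal. f_equal. rewrite <- IH. clear IH.
    (* All rounds but the last read the bits of [v], found one position higher in [b :: v]; the last
       round reads [b]. *)
    assert (H : forall k, k <= length v ->
      nat_rect (fun _ => nat) (4 * enc w + 2) (fun i r =>
        4 * r + 3 * ((enc (b :: v) / 2 ^ (S (length v) - S i)) mod 2)) k =
      nat_rect (fun _ => nat) (4 * enc w + 2) (fun i r =>
        4 * r + 3 * ((enc v / 2 ^ (length v - S i)) mod 2)) k); [|now apply H].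
    induction k as [|k IH]; intros Hk; [reflexivity|]. cbn [nat_rect].
    rewrite IH by lia. do 3 f_equal.
    replace (S (length v) - S k) with (S (length v - S k)) by lia.
    rewrite Nat.pow_succ_r', <- Nat.Div0.div_div. f_equal. cbn [enc].
    rewrite Nat.mul_comm, Nat.div_add_l by lia.
    rewrite (Nat.div_small (if b then 1 else 0)) by (destruct b; lia). lia.
  - assert (enc (b :: v) mod 2 = if b then 1 else 0) as ->.
    { cbn [enc]. rewrite Nat.add_comm, (Nat.mul_comm 2), Nat.Div0.mod_add.
      now destruct b. }
    change (enc (pair_enc (b :: v) w)) with
      (2 * (2 * enc (pair_enc v w) + (if b then 1 else 0)) + (if b then 1 else 0)).
    destruct b; lia.
Qed.

Lemma pair_enc_inj v w v' w' : pair_enc v w = pair_enc v' w' -> v = v' /\ w = w'.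
Proof.
  revert v'. induction v as [|b v IH]; intros [|b' v'] H; cbn in H.
  - now injection H.
  - exfalso. injection H as H1 H2. destruct b'; discriminate.
  - exfalso. injection H as H1 H2. destruct b; discriminate.
  - injection H as H1 _ H3. destruct (IH v' H3). subst. auto.
Qed.

Lemma pcode_lt v w : enc v < enc (pair_enc v w) /\ enc w < enc (pair_enc v w).
Proof.
  induction v as [|b v [IH1 IH2]].
  - cbn. lia.
  - change (enc (pair_enc (b :: v) w)) with
      (2 * (2 * enc (pair_enc v w) + (if b then 1 else 0)) + (if b then 1 else 0)).
    cbn [enc]. lia.
Qed.

(** Decoding by bounded search is visibly computable; candidates equal to [0] are excluded as they
    code no string. *)
Definition pfst (z : nat) : nat :=
  bmin z (fun v => (0 <? v) && bex z (fun w => (0 <? w) && (pcode v w =? z))).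

Definition psnd (z : nat) : nat :=
  bmin z (fun w => (0 <? w) && bex z (fun v => (0 <? v) && (pcode v w =? z))).

Lemma pcode_inj v w a b :
  0 < v -> 0 < w -> pcode v w = enc (pair_enc a b) -> v = enc a /\ w = enc b.
Proof.
  intros Hv Hw. destruct (enc_surj v Hv) as [v' <-], (enc_surj w Hw) as [w' <-].
  rewrite pcode_enc. intros H. now destruct (pair_enc_inj _ _ _ _ (enc_inj _ _ H)) as [-> ->].
Qed.

Lemma pfst_enc v w : pfst (enc (pair_enc v w)) = enc v.
Proof.
  destruct (pcode_lt v w). pose proof (enc_pos v). pose proof (enc_pos w).
  apply bmin_least; auto.
  - apply andb_true_iff. split; [now apply Nat.ltb_lt|]. apply bex_spec.
    exists (enc w). split; [assumption|]. apply andb_true_iff.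
    split; [now apply Nat.ltb_lt|]. apply Nat.eqb_eq, pcode_enc.
  - intros j Hj. apply not_true_iff_false. rewrite andb_true_iff, bex_spec, Nat.ltb_lt.
    intros (Hj0 & i & Hi & Hp). rewrite andb_true_iff, Nat.ltb_lt, Nat.eqb_eq in Hp.
    destruct Hp as [Hi0 Hp]. destruct (pcode_inj j i v w Hj0 Hi0 Hp). lia.
Qed.

Lemma psnd_enc v w : psnd (enc (pair_enc v w)) = enc w.
Proof.
  destruct (pcode_lt v w). pose proof (enc_pos v). pose proof (enc_pos w).
  apply bmin_least; auto.
  - apply andb_true_iff. split; [now apply Nat.ltb_lt|]. apply bex_spec.
    exists (enc v). split; [assumption|]. apply andb_true_iff.
    split; [now apply Nat.ltb_lt|]. apply Nat.eqb_eq, pcode_enc.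
  - intros j Hj. apply not_true_iff_false. rewrite andb_true_iff, bex_spec, Nat.ltb_lt.
    intros (Hj0 & i & Hi & Hp). rewrite andb_true_iff, Nat.ltb_lt, Nat.eqb_eq in Hp.
    destruct Hp as [Hi0 Hp]. destruct (pcode_inj i j v w Hi0 Hj0 Hp). lia.
Qed.

Lemma length_pair_enc v w : length (pair_enc v w) = 2 * length v + 2 + length w.
Proof.
  induction v as [|b v IH]; [reflexivity|].
  change (length (pair_enc (b :: v) w)) with (S (S (length (pair_enc v w)))).
  cbn [length]. lia.
Qed.

Lemma comp_pcode n f g : comp n f -> comp n g -> comp n (fun l => pcode (f l) (g l)).
Proof.
  intros Hf Hg. unfold pcode. comp_auto. Qed.

Lemma comp_pfst n f : comp n f -> comp n (fun l => pfst (f l)).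
Proof. intros Hf. unfold pfst. comp_auto. apply comp_pcode; comp_auto. Qed.

Lemma comp_psnd n f : comp n f -> comp n (fun l => psnd (f l)).
Proof. intros Hf. unfold psnd. comp_auto. apply comp_pcode; comp_auto. Qed.

Definition digit (B f x : nat) : nat := (f / B ^ x) mod B.

(** Horner's rule: the table of the shifted function is multiplied by [B] and [g 0] becomes the
    lowest digit. *)
Lemma digit_exists B n : forall g, (forall x, x < n -> g x < B) ->
  exists f, f < B ^ n /\ forall x, x < n -> digit B f x = g x.
Proof.
  induction n as [|n IH]; intros g Hg.
  - exists 0. simpl. split; lia.
  - destruct (IH (fun x => g (S x))) as (f & Hf & H); [intros; apply Hg; lia|].
    pose proof (Hg 0 ltac:(lia)).
    exists (B * f + g 0). split; [rewrite Nat.pow_succ_r'; nia|].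
    intros [|x] Hx; unfold digit.
    + rewrite Nat.pow_0_r, Nat.div_1_r, Nat.add_comm, (Nat.mul_comm B), Nat.Div0.mod_add.
      now apply Nat.mod_small.
    + rewrite Nat.pow_succ_r', <- Nat.Div0.div_div, (Nat.mul_comm B f),
        Nat.div_add_l, (Nat.div_small (g 0)), Nat.add_0_r by lia.
      apply H. lia.
Qed.

Lemma comp_digit n B f x :
  comp n B -> comp n f -> comp n x -> comp n (fun l => digit (B l) (f l) (x l)).
Proof. intros. unfold digit. comp_auto. Qed.

(** The string with code [pcode n (S f)] stands for the function on [{0, ..., 2^n - 1}]
    tabulated by the base-[2^n] digits of [f]; the successor keeps the code positive. *)
Definition apply_table (z x : nat) : nat := digit (2 ^ pfst z) (pred (psnd z)) x.

Lemma comp_apply_table n f x :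
  comp n f -> comp n x -> comp n (fun l => apply_table (f l) (x l)).
Proof.
  intros Hf Hx. apply comp_digit; comp_auto; now (apply comp_pfst + apply comp_psnd).
Qed.

Ltac comp_defined ::=
  lazymatch goal with
  | |- comp _ (fun l => _ / _) => apply comp_div
  | |- comp _ (fun l => _ mod _) => apply comp_mod
  | |- comp _ (fun l => Nat.log2 _) => apply comp_log2
  | |- comp _ (fun l => pcode _ _) => apply comp_pcode
  | |- comp _ (fun l => pfst _) => apply comp_pfst
  | |- comp _ (fun l => psnd _) => apply comp_psnd
  | |- comp _ (fun l => digit _ _ _) => apply comp_digit
  | |- comp _ (fun l => apply_table _ _) => apply comp_apply_table
  | |- comp _ (fun l => run _ _ [_; _]) => apply comp_run
  end.

(** * The greedy matching of bad pairs *)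

Section Greedy.

Variable t : mrec.

(** Stage [s] tests the pair [(left_of n s, right_of n s)] for badness within time
    [time_of n s]; every pair of components below [2 ^ n] recurs with every time. *)
Definition left_of (n s : nat) : nat := s mod 2 ^ n.
Definition right_of (n s : nat) : nat := (s / 2 ^ n) mod 2 ^ n.
Definition time_of (n s : nat) : nat := s / 2 ^ n / 2 ^ n.

(** The nested [negb] spell an implication. The codes below [2 ^ m] are those of the strings shorter
    than [m], together with [0]. *)
Definition bad (c n m x y s : nat) : bool :=
  ball ((2 ^ n) ^ (2 ^ n)) (fun f => negb ((digit (2 ^ n) f x =? y) &&
    negb (bex (2 ^ m) (fun q => run s t [q; pcode c (pcode n (S f))] =? S y)))).

(** Greedy choice is a course-of-values recursion; packing the earlier choices into the number [h]
    makes it primitive recursive. *)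
Definition fresh (n h s : nat) : bool :=
  ball s (fun j => negb (((h / 2 ^ (s - S j)) mod 2 =? 1) &&
    negb (negb (left_of n j =? left_of n s) && negb (right_of n j =? right_of n s)))).

Definition chosen (c n m h s : nat) : bool :=
  bad c n m (left_of n s) (right_of n s) (time_of n s) && fresh n h s.

(** The binary digits of [history c n m s] are the choices made before stage [s], the
    latest one being the lowest digit. *)
Definition history (c n m s : nat) : nat :=
  nat_rect (fun _ => nat) 0 (fun k h => 2 * h + Nat.b2n (chosen c n m h k)) s.

Definition selected (c n m s : nat) : bool := chosen c n m (history c n m s) s.

(** The position of a stage among the selected ones, used below as a short name for its pair. *)
Definition rank (c n m s : nat) : nat :=
  nat_rect (fun _ => nat) 0 (fun k r => r + Nat.b2n (selected c n m k)) s.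

Lemma compb_chosen k c n m h s :
  comp k c -> comp k n -> comp k m -> comp k h -> comp k s ->
  compb k (fun l => chosen (c l) (n l) (m l) (h l) (s l)).
Proof.
  intros. unfold chosen, bad, fresh, left_of, right_of, time_of. comp_auto.
Qed.

Lemma comp_history k c n m s :
  comp k c -> comp k n -> comp k m -> comp k s ->
  comp k (fun l => history (c l) (n l) (m l) (s l)).
Proof.
  intros. unfold history. comp_auto. apply compb_chosen; comp_auto.
Qed.

Lemma compb_selected k c n m s :
  comp k c -> comp k n -> comp k m -> comp k s ->
  compb k (fun l => selected (c l) (n l) (m l) (s l)).
Proof.
  intros. unfold selected. apply compb_chosen; comp_auto. now apply comp_history.
Qed.

Lemma comp_rank k c n m s :
  comp k c -> comp k n -> comp k m -> comp k s ->
  comp k (fun l => rank (c l) (n l) (m l) (s l)).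
Proof.
  intros. unfold rank. comp_auto. apply compb_selected; comp_auto.
Qed.

Lemma history_digit c n m s j : j < s ->
  ((history c n m s / 2 ^ (s - S j)) mod 2 =? 1) = selected c n m j.
Proof.
  induction s as [|s IH]; intros Hj; [lia|].
  change (history c n m (S s)) with (2 * history c n m s + Nat.b2n (selected c n m s)).
  destruct (Nat.eq_dec j s) as [->|Hne].
  - rewrite Nat.sub_diag, Nat.pow_0_r, Nat.div_1_r, Nat.add_comm, (Nat.mul_comm 2),
      Nat.Div0.mod_add.
    now destruct (selected c n m s).
  - rewrite <- IH by lia. replace (S s - S j) with (S (s - S j)) by lia.
    rewrite Nat.pow_succ_r', <- Nat.Div0.div_div, (Nat.mul_comm 2),
      Nat.div_add_l, (Nat.div_small (Nat.b2n _)), Nat.add_0_r by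
        (destruct (selected c n m s); simpl; lia).
    reflexivity.
Qed.

Lemma selected_spec c n m s :
  selected c n m s = true <->
  bad c n m (left_of n s) (right_of n s) (time_of n s) = true /\
  forall j, j < s -> selected c n m j = true ->
    left_of n j <> left_of n s /\ right_of n j <> right_of n s.
Proof.
  unfold selected at 1, chosen, fresh. rewrite andb_true_iff, ball_spec.
  apply and_iff_compat_l. split; intros H j Hj.
  - intros Hs. specialize (H j Hj). rewrite history_digit, Hs in H by assumption.
    cbn [andb] in H. rewrite negb_involutive, andb_true_iff, !negb_true_iff, !Nat.eqb_neq in H.
    exact H.
  - rewrite history_digit by assumption. destruct (selected c n m j) eqn:E; [|reflexivity].
    cbn [andb]. rewrite negb_involutive, andb_true_iff, !negb_true_iff, !Nat.eqb_neq.
    exact (H j Hj E).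
Qed.

Lemma rank_S c n m s : rank c n m (S s) = rank c n m s + Nat.b2n (selected c n m s).
Proof. reflexivity. Qed.

Lemma rank_mono c n m s s' :
  s < s' -> selected c n m s = true -> rank c n m s < rank c n m s'.
Proof.
  intros Hs Hsel. induction Hs as [|s' _ IH]; rewrite rank_S.
  - rewrite Hsel. simpl. lia.
  - lia.
Qed.

Lemma rank_inj c n m s s' :
  selected c n m s = true -> selected c n m s' = true ->
  rank c n m s = rank c n m s' -> s = s'.
Proof.
  intros H H' E. destruct (Nat.lt_trichotomy s s') as [L|[L|L]]; auto.
  - apply (rank_mono c n m) in L; [lia|auto].
  - apply (rank_mono c n m) in L; [lia|auto].
Qed.

Lemma rank_length c n m s :
  rank c n m s = length (filter (selected c n m) (seq 0 s)).
Proof.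
  induction s as [|s IH]; [reflexivity|].
  rewrite rank_S, seq_S, filter_app, length_app, <- IH. simpl.
  f_equal.
  now destruct (selected c n m s).
Qed.

(** * Size and covering property of the matching *)

Definition outputs (c n m f y : nat) : Prop :=
  exists q, q < 2 ^ m /\ exists s, run s t [q; pcode c (pcode n (S f))] = S y.

Lemma bad_spec c n m x y s :
  bad c n m x y s = true <->
  forall f, f < (2 ^ n) ^ (2 ^ n) -> digit (2 ^ n) f x = y ->
    exists q, q < 2 ^ m /\ run s t [q; pcode c (pcode n (S f))] = S y.
Proof.
  unfold bad. rewrite ball_spec. split; intros H f Hf.
  - intros Hd. specialize (H f Hf).
    rewrite (proj2 (Nat.eqb_eq _ _) Hd), andb_true_l, negb_involutive, bex_spec in H.
    destruct H as (q & Hq & H). exists q. now rewrite Nat.eqb_eq in H.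
  - destruct (Nat.eqb_spec (digit (2 ^ n) f x) y) as [E|]; [|reflexivity].
    rewrite andb_true_l, negb_involutive, bex_spec.
    destruct (H f Hf E) as (q & Hq & H'). exists q. now rewrite Nat.eqb_eq.
Qed.

(** Pick one program code for each element; by determinism distinct outputs have distinct codes. *)
Lemma outputs_card c n m f ys :
  NoDup ys -> Forall (outputs c n m f) ys -> length ys <= 2 ^ m.
Proof.
  intros Hnd Hys.
  assert (exists qs, Forall2 (fun q y => q < 2 ^ m /\
    exists s, run s t [q; pcode c (pcode n (S f))] = S y) qs ys) as [qs Hqs].
  { clear Hnd. induction Hys as [|y ys [q Hq] _ [qs IH]]; [now exists []|].
    exists (q :: qs). now constructor. }
  rewrite <- (Forall2_length Hqs), <- (length_seq (2 ^ m) 0).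
  apply NoDup_incl_length.
  - revert Hnd. clear Hys. induction Hqs as [|q y qs ys Hq Hqs IH]; intros Hnd; constructor.
    + inversion Hnd as [|? ? Hy _]; subst. intros Hin. apply Hy.
      destruct Hq as [_ Hq]. apply eval_run in Hq. clear -Hqs Hin Hq.
      induction Hqs as [|q' y' qs ys [_ Hq'] _ IH]; [easy|].
      destruct Hin as [->|Hin]; [left|right; auto].
      apply eval_run in Hq'. now apply eval_fun with (1 := Hq').
    + inversion Hnd; auto.
  - intros q Hq. apply in_seq. split; [lia|].
    clear -Hqs Hq. induction Hqs as [|q' y qs ys [H _] _ IH]; [easy|].
    destruct Hq as [->|Hq]; auto.
Qed.

(** Distinct left components make the listed pairs the graph of a partial function, extended by
    [0]. *)
Lemma function_through n (l : list nat) :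
  NoDup (map (left_of n) l) ->
  exists g, (forall x, g x < 2 ^ n) /\ forall s, In s l -> g (left_of n s) = right_of n s.
Proof.
  pose proof (Nat.pow_nonzero 2 n ltac:(lia)).
  induction l as [|s l IH]; intros Hnd.
  - exists (fun _ => 0). split; [lia|easy].
  - inversion Hnd as [|? ? Hs Hl]; subst. destruct (IH Hl) as (g & Hg & Hgl).
    exists (fun x => if x =? left_of n s then right_of n s else g x). split.
    + intros x. destruct (x =? left_of n s); [|apply Hg].
      apply Nat.mod_upper_bound. assumption.
    + intros s' [->|Hin]; [now rewrite Nat.eqb_refl|].
      destruct (Nat.eqb_spec (left_of n s') (left_of n s)) as [E|]; [|auto].
      destruct Hs. rewrite <- E. now apply in_map.
Qed.

Lemma NoDup_map_selected (e : nat -> nat) c n m :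
  (forall j s, j < s -> selected c n m j = true -> selected c n m s = true -> e j <> e s) ->
  forall k, NoDup (map e (filter (selected c n m) (seq 0 k))).
Proof.
  intros He k. apply NoDup_map_NoDup_ForallPairs; [|apply NoDup_filter, seq_NoDup].
  intros i j Hi Hj E. apply filter_In in Hi as [_ Hi], Hj as [_ Hj].
  destruct (Nat.lt_trichotomy i j) as [L|[L|L]]; auto; exfalso.
  - now apply (He i j).
  - now apply (He j i).
Qed.

(** A table extending the selected pairs outputs all their right components, since
    each selected pair is bad. *)
Lemma rank_bound c n m s : selected c n m s = true -> rank c n m s < 2 ^ m.
Proof.
  intros Hs.
  (* Counting stage [s] itself turns the weak bound into the strict one. *)
  enough (rank c n m (S s) <= 2 ^ m).
  { pose proof (rank_mono c n m s (S s) ltac:(lia) Hs). lia. }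
  rewrite rank_length. set (l := filter _ _).
  destruct (function_through n l) as (g & Hg & Hgl).
  { apply NoDup_map_selected. intros i j Hij Hi Hj. apply selected_spec in Hj.
    now apply Hj. }
  destruct (digit_exists (2 ^ n) (2 ^ n) g) as (f & Hf & Hd); [auto|].
  rewrite <- (length_map (right_of n)). apply (outputs_card c n m f).
  - apply NoDup_map_selected. intros i j Hij Hi Hj. apply selected_spec in Hj.
    now apply Hj.
  - apply Forall_map, Forall_forall. intros j Hj.
    assert (selected c n m j = true) as Hb by (now apply filter_In in Hj).
    apply selected_spec in Hb as [Hb _]. rewrite bad_spec in Hb.
    destruct (Hb f Hf) as (q & Hq & H).
    + rewrite Hd; [auto|]. apply Nat.mod_upper_bound, Nat.pow_nonzero. lia.
    + exists q. eauto.
Qed.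

(** One time bound [k] serves all the finitely many tables, so the pair is seen to be bad at a stage
    testing it with time [k]. There it is selected, or blocked by an earlier selected pair sharing a
    component. *)
Lemma selected_cover c n m x y :
  x < 2 ^ n -> y < 2 ^ n ->
  (forall f, f < (2 ^ n) ^ (2 ^ n) -> digit (2 ^ n) f x = y -> outputs c n m f y) ->
  exists s, selected c n m s = true /\ (left_of n s = x \/ right_of n s = y).
Proof.
  intros Hx Hy H.
  destruct (bounded_stage (fun f s => digit (2 ^ n) f x = y ->
    exists q, q < 2 ^ m /\ run s t [q; pcode c (pcode n (S f))] = S y)
    ((2 ^ n) ^ (2 ^ n))) as [k Hk].
  { intros f s s' Hs Hf Hd. destruct (Hf Hd) as (q & Hq & Hr).
    exists q. split; [assumption|]. now apply run_mono with s. }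
  { intros f Hf. destruct (Nat.eq_dec (digit (2 ^ n) f x) y) as [E|].
    - destruct (H f Hf E) as (q & Hq & s & Hs). eauto.
    - now exists 0. }
  (* The stage whose components are [x] and [y] and whose time is [k]. *)
  set (s := (k * 2 ^ n + y) * 2 ^ n + x).
  assert (s / 2 ^ n = k * 2 ^ n + y) as Hdiv.
  { unfold s. rewrite Nat.div_add_l, (Nat.div_small x) by lia. lia. }
  assert (left_of n s = x) as Hl.
  { unfold left_of, s. rewrite Nat.add_comm, Nat.Div0.mod_add. now apply Nat.mod_small. }
  assert (right_of n s = y) as Hr.
  { unfold right_of. rewrite Hdiv, Nat.add_comm, Nat.Div0.mod_add.
    now apply Nat.mod_small. }
  assert (time_of n s = k) as Ht.
  { unfold time_of. rewrite Hdiv, Nat.div_add_l, (Nat.div_small y) by lia. lia. }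
  destruct (selected c n m s) eqn:Es; [eauto|].
  apply not_true_iff_false in Es. rewrite selected_spec, Hl, Hr, Ht in Es.
  apply NNPP. intros Hno. apply Es. split; [now apply bad_spec|].
  intros j Hj Hsel. split; intros E; apply Hno; eauto.
Qed.

End Greedy.

(** A program [pair_enc u w] with [enc u = n] and [length w = m] designates the selected
    pair whose rank is the number written by [w]; the leading one of [enc w] is removed by
    [- 2 ^ m]. *)
Definition selected_vertex (t : mrec) (e : nat -> nat -> nat) (s p c : nat) : nat :=
  let n := pfst p in
  let w := psnd p in
  let m := Nat.log2 w in
  if selected t c n m s && (rank t c n m s =? w - 2 ^ m) then S (e n s) else 0.

Lemma comp_selected_vertex t e :
  comp 2 (fun l => e (nth 0 l 0) (nth 1 l 0)) ->
  comp 3 (fun l => selected_vertex t e (nth 0 l 0) (nth 1 l 0) (nth 2 l 0)).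
Proof.
  intros He. unfold selected_vertex. cbv zeta. comp_auto.
  - apply compb_selected; comp_auto.
  - apply comp_rank; comp_auto.
  - apply (comp_list 3 2 (fun l => e (nth 0 l 0) (nth 1 l 0))
      [fun l => pfst (nth 1 l 0); fun l => nth 0 l 0]); auto.
    repeat constructor; comp_auto.
Qed.

(** Given [c], a component of a selected pair is named by [n] and a rank, and [rank_bound] lets the
    rank fit in [m] bits. The code [u] of [n] is doubled by [pair_enc], whose separator costs two
    more bits. *)
Lemma KS_selected_vertex D t e (HD : optimal D) :
  comp 2 (fun l => e (nth 0 l 0) (nth 1 l 0)) ->
  exists C, forall u m c x s,
    selected t (enc c) (enc u) m s = true -> e (enc u) s = enc x ->
    KS D x c <= 2 * length u + m + C.
Proof.
  intros He.
  destruct (optimal_bound D HD (selected_vertex t e)) as [C HC];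
    [now apply comp_selected_vertex|].
  exists (C + 2). intros u m c x s Hs Hx.
  pose proof (rank_bound t _ _ _ _ Hs) as Hr.
  pose proof (Nat.pow_nonzero 2 m ltac:(lia)).
  (* Adding [2 ^ m] supplies the leading one of [enc], so that [w] has exactly [m] bits. *)
  destruct (enc_surj (2 ^ m + rank t (enc c) (enc u) m s)) as [w Hw]; [lia|].
  assert (Hm : length w = m).
  { rewrite <- log2_enc, Hw. apply Nat.log2_unique; [lia|].
    rewrite Nat.pow_succ_r'. lia. }
  destruct (HC (pair_enc u w) c x s) as [_ Hk].
  - unfold selected_vertex. cbv zeta.
    rewrite pfst_enc, psnd_enc, log2_enc, Hm, Hs, Hw, Nat.add_comm, Nat.add_sub,
      Nat.eqb_refl, Hx.
    reflexivity.
  - intros s' z. unfold selected_vertex. cbv zeta.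
    rewrite pfst_enc, psnd_enc, log2_enc, Hm, Hw, Nat.add_comm, Nat.add_sub.
    destruct (selected t (enc c) (enc u) m s') eqn:Es'; [|discriminate].
    destruct (Nat.eqb_spec (rank t (enc c) (enc u) m s') (rank t (enc c) (enc u) m s))
      as [E|]; [|discriminate].
    apply rank_inj in E as ->; [|auto..]. simpl. congruence.
  - rewrite length_pair_enc, Hm in Hk. lia.
Qed.

(** The machine that prints its own program gives every string a description under every
    condition. *)
Lemma KS_defined D (HD : optimal D) x y : KS_spec D x y (KS D x y).
Proof.
  destruct (optimal_bound D HD (fun _ p _ => S p)) as [C HC]; [comp_auto|].
  apply (HC x y x 0); congruence.
Qed.

Theorem theorem2 (D : decompressor) (HD : optimal D) :
  exists C : nat, forall N : nat, 2 <= N ->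
    forall a b c : bits,
      length a <= N -> length b <= N -> length c <= N ->
      exists f : bits,
        KS2 D b a f <= C * Nat.log2 N /\
        KS2 D b c f <= Nat.min (KS D a c) (KS D b c) + C * Nat.log2 N /\
        Nat.min (KS D a c) (KS D b c) <= KS2 D b c f + C * Nat.log2 N.
Proof.
  destruct (proj1 HD) as [t Ht].
  assert (Hrun : forall p y z s s', D p y = Some z ->
    run s' t [enc p; enc y] = S s -> s = enc z).
  { intros p y z s s' Hp Hs. apply Ht in Hp. apply run_sound in Hs.
    now apply eval_fun with (1 := Hs). }
  (* Three machines: evaluate the table at [a]; run a program for [b] on [c]; run a program for [a]
     on [c] and send the result through the table. *)
  destruct (optimal_bound D HD (fun _ _ y => S (apply_table (psnd y) (pfst y))))
    as [C1 H1]; [comp_auto|].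
  destruct (optimal_bound D HD (fun s p y => run s t [p; pfst y]))
    as [C2 H2]; [comp_auto|].
  destruct (optimal_bound D HD (fun s p y =>
      let r := run s t [p; pfst y] in
      if r =? 0 then 0 else S (apply_table (psnd y) (pred r))))
    as [C3 H3]; [cbv zeta; comp_auto|].
  destruct (KS_selected_vertex D t left_of HD) as [C4 H4]; [unfold left_of; comp_auto|].
  destruct (KS_selected_vertex D t right_of HD) as [C5 H5]; [unfold right_of; comp_auto|].
  (* As [L] is at least [1], additive constants are absorbed in [C * L]; the [10] covers
     [2 * length u], at most [2 * L + 2], with room for strictness. *)
  set (C := 10 + C1 + C2 + C3 + C4 + C5). exists C.
  intros N HN a b c Ha Hb _.
  pose proof (Nat.log2_pos N ltac:(lia)) as Hlog.
  set (L := Nat.log2 N) in *. set (k := Nat.min (KS D a c) (KS D b c)).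
  (* Tables are taken with [n = S N], since strings of length at most [N] have codes below
     [2 ^ S N]. *)
  destruct (enc_surj (S N)) as [u Hu]; [lia|].
  assert (length u <= S L) as Hul.
  { rewrite <- log2_enc, Hu. apply Nat.log2_succ_le. }
  assert (forall v, length v <= N -> enc v < 2 ^ S N) as Hlt.
  { intros v Hv. apply Nat.lt_le_trans with (1 := proj2 (enc_bounds v)).
    apply Nat.pow_le_mono_r; lia. }
  pose proof (Hlt a Ha) as Hea. pose proof (Hlt b Hb) as Heb.
  apply NNPP. intros Hno.
  assert (forall i, digit (2 ^ S N) i (enc a) = enc b -> exists f,
    enc f = pcode (S N) (S i) /\ KS D b (pair_enc c f) + C * L < k) as Hf.
  { intros i Hi. destruct (enc_surj (S i)) as [w Hw]; [lia|].
    set (f := pair_enc u w). exists f.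
    split; [unfold f; now rewrite <- pcode_enc, Hu, Hw|].
    assert (apply_table (enc f) (enc a) = enc b) as Hab.
    { unfold apply_table, f. rewrite pfst_enc, psnd_enc, Hu, Hw. exact Hi. }
    destruct (KS_defined D HD b c) as [(p & Hp & Hpl) _].
    destruct (KS_defined D HD a c) as [(q & Hq & Hql) _].
    (* Both upper bounds hold for every table sending [a] to [b], so if the lower bound held too,
       [f] would be the string sought. *)
    apply Nat.lt_nge. intros Hge. apply Hno. exists f. unfold KS2. repeat split.
    - destruct (H1 [] (pair_enc a f) b 0) as [_ H].
      + now rewrite pfst_enc, psnd_enc, Hab.
      + intros _ z. rewrite pfst_enc, psnd_enc, Hab. congruence.
      + simpl in H. unfold C. nia.
    - assert (KS D b (pair_enc c f) <= KS D b c + C2).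
      { destruct (proj1 (eval_run _ _ _) (proj1 (Ht _ _ _) Hp)) as [s Hs].
        rewrite <- Hpl. apply (H2 p (pair_enc c f) b s); rewrite pfst_enc; [exact Hs|].
        intros s' z. now apply Hrun. }
      assert (KS D b (pair_enc c f) <= KS D a c + C3).
      { destruct (proj1 (eval_run _ _ _) (proj1 (Ht _ _ _) Hq)) as [s Hs].
        rewrite <- Hql. apply (H3 q (pair_enc c f) b s); cbv zeta;
          rewrite pfst_enc, psnd_enc.
        - rewrite Hs. simpl. now rewrite Hab.
        - intros s' z. destruct (run s' t _) as [|r] eqn:E; [discriminate|].
          apply (Hrun _ _ _ _ _ Hq) in E as ->. simpl. rewrite Hab. congruence. }
      unfold k, C. nia.
    - exact Hge. }
  (* The constant table shows that some table sends [a] to [b]; hence [C * L < k] and the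
     subtraction [k - C * L] is not truncated. *)
  destruct (digit_exists (2 ^ S N) (2 ^ S N) (fun _ => enc b)) as (i & _ & Hi); [auto|].
  destruct (Hf i (Hi _ Hea)) as (f & _ & Hk).
  (* By [Hf], each table sending [a] to [b] yields [b] from a program shorter than [k - C * L], so
     this is the threshold [m] at which the pair is bad. *)
  destruct (selected_cover t (enc c) (S N) (k - C * L) (enc a) (enc b)) as (s & Hs & Hv);
    [assumption..| |].
  - clear i Hi f Hk. intros i _ Hi. destruct (Hf i Hi) as (f & Hfe & Hk).
    destruct (KS_defined D HD b (pair_enc c f)) as [(q & Hq & Hql) _].
    exists (enc q). split.
    + apply Nat.lt_le_trans with (1 := proj2 (enc_bounds q)).
      apply Nat.pow_le_mono_r; lia.
    + rewrite <- Hfe, pcode_enc. now apply eval_run, Ht.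
  (* Now [a] or [b] lies in a selected pair, so its complexity given [c] falls below [k],
     contradicting the choice of [k] as the minimum. *)
  - rewrite <- Hu in Hs, Hv.
    assert (k <= 2 * length u + (k - C * L) + C4 + C5).
    { destruct Hv as [Hv|Hv].
      - specialize (H4 _ _ _ _ _ Hs Hv). unfold k in *. lia.
      - specialize (H5 _ _ _ _ _ Hs Hv). unfold k in *. lia. }
    assert (2 * length u + C4 + C5 < C * L) by (unfold C; nia).
    lia.
Qed.
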